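(* Let $0<p<1/2$, $q:=1-p$, and let $(B_i)_{i\ge1}$ be independent random variables with $\mathbb{P}(B_i=1)=1-\mathbb{P}(B_i=0)=p$. Let $\rho_*,\kappa,\beta$ and $M_n$ be as defined in the context. Then for every bounded interval $I\subset\mathbb{R}$, as $n\to\infty$, $$\mathbb{P}\left\{M_n<\rho_* n-\frac{\ln(\beta n)}{2|\ln\kappa|}+z\right\}=\exp\left\{-\frac{\kappa^{z}}{1-\kappa}\,(1+\varepsilon_n(z))\right\},$$ where $\varepsilon_n(z)\to0$ uniformly over $z\in I\cap\left[\mathbb{Z}-\rho_* n+\frac{\ln(\beta n)}{2|\ln\kappa|}\right]$, i.e. uniformly over those $z\in I$ for which $\rho_* n-\frac{\ln(\beta n)}{2|\ln\kappa|}+z$ is an integer.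
   Context: Let $S_n:=\sum_{i=1}^n B_i$, let $S_n^{(j)}$, $1\le j\le 2^n$, be independent copies of $S_n$, and let $M_n:=\max_{1\le j\le 2^n}S_n^{(j)}$. The number $\rho_*\in(0,1)$ is the solution $\rho$ of the equation $2p^{\rho}q^{1-\rho}=\rho^{\rho}(1-\rho)^{1-\rho}$. Further, $\kappa:=\frac{p(1-\rho_* )}{q\rho_*}\in(0,1)$ and $\beta:=2\pi\rho_*(1-\rho_* )$. *)

(* Defs.v *)
From HB Require Import structures.
From mathcomp Require Import all_boot all_order all_algebra.
From mathcomp Require Import all_classical all_reals all_analysis.

Set Implicit Arguments.
Unset Strict Implicit.
Unset Printing Implicit Defensive.

Import Order.TTheory GRing.Theory Num.Theory.
Import numFieldTopology.Exports numFieldNormedType.Exports.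

Local Open Scope classical_set_scope.
Local Open Scope ring_scope.

Section constants.
Context {R : realType}.
Implicit Types (p : R) (n : nat).

(* For 0 < p < 1/2 exactly one rho satisfies the condition, so the choice made
   by [xget] is immaterial and its default value 0 is never taken. *)
Definition rho_star p : R :=
  xget 0 [set rho : R | 0 < rho < 1 /\
    2 * p `^ rho * (1 - p) `^ (1 - rho) =
    rho `^ rho * (1 - rho) `^ (1 - rho)].

Definition kappa p : R := p * (1 - rho_star p) / ((1 - p) * rho_star p).

Definition beta p : R := 2 * pi * rho_star p * (1 - rho_star p).

Definition centering p n : R :=
  rho_star p * n%:R - ln (beta p * n%:R) / (2 * `|ln (kappa p)|).

End constants.

Section random_variables.
Context {d : measure_display} {T : measurableType d} {R : realType}.
Variable P : probability T R.

(* Mutual independence: the product rule for every finite subfamily, a finite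
   set of indices being given as a duplicate-free sequence. *)
Definition mutually_independent (J : eqType) (X : J -> {RV P >-> R}) : Prop :=
  forall (s : seq J) (A : J -> set R), uniq s ->
    (forall j, j \in s -> measurable (A j)) ->
    P (\bigcap_(j in [set` s]) (X j @^-1` A j)) =
    (\prod_(j <- s) P (X j @^-1` A j))%E.

Definition identically_distributed (X Y : T -> R) : Prop :=
  forall A : set R, measurable A -> P (X @^-1` A) = P (Y @^-1` A).

Definition bernoulli_RV (p : R) (X : {RV P >-> R}) : Prop :=
  P [set w | X w = 1] = p%:E /\ P [set w | X w = 0] = (1 - p)%:E.

(* The sequence B_1, B_2, ... is indexed from 0, so S_n = B 0 + ... + B n.-1. *)
Definition partial_sum (B : nat -> {RV P >-> R}) (n : nat) (w : T) : R :=
  \sum_(i < n) B i w.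

Definition independent_copies (J : eqType) (X : T -> R)
    (Y : J -> {RV P >-> R}) : Prop :=
  mutually_independent Y /\ forall j, identically_distributed (Y j) X.

Lemma exp2_gt0 n : (0 < 2 ^ n)%N.
Proof. by rewrite expn_gt0. Qed.

(* The iterated maximum starts from the value of the first copy (rather than
   from 0), so that it is exactly the largest of the 2 ^ n values. *)
Definition max_copies n (Y : 'I_(2 ^ n) -> {RV P >-> R}) (w : T) : R :=
  \big[Num.max/Y (Ordinal (exp2_gt0 n)) w]_(j < 2 ^ n) Y j w.

End random_variables.

(* Main.v *)
Require Import Defs.
From HB Require Import structures.
From mathcomp Require Import all_boot all_order all_algebra.
From mathcomp Require Import all_classical all_reals all_analysis.
From mathcomp Require Import ring lra zify.

Import Order.TTheory GRing.Theory Num.Theory.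
Import numFieldTopology.Exports numFieldNormedType.Exports.

(** The copies being independent, P(M_n < k) = (1 - Q) ^ (2^n) with
    Q = P(S_n >= k) a binomial upper tail, so that ln P(M_n < k) is
    2^n ln (1 - Q), equivalent to - 2^n Q as Q tends to 0.  Everything thus
    reduces to showing that, for integers k at bounded distance z from the
    centering, 2^n Q kappa^(-z) tends to 1 / (1 - kappa).

    First, one term of the tail dominates: writing b k = P(S_n = k), consecutive
    terms near k have ratio close to kappa, and Q / b k tends to the sum
    1 / (1 - kappa) of the geometric series.  No series is manipulated:
    summing the recurrence (j+1) q b (j+1) = (n-j) p b j over j >= k gives the
    exact identity (k - p n) Q + V = q k b k ([binom_tail_excess]), where
    V, the sum of (j - k) b j, is of smaller order ([binom_excess_le]).

    Next, the single term: 2^n b k kappa^(-z) tends to 1 ([scaled_log_cvg0]).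
    The logarithm of the binomial coefficient is expanded by Stirling's formula
    ([stirling_log_lim]), and the exponential rate is split as
    2^n p^k q^(n-k) = rho^k (1-rho)^(n-k) kappa^(k - rho n), by the
    equation defining rho = rho_star.  The first two factors combine with the
    binomial coefficient into a local probability of the binomial law of
    parameter rho, of size (beta n)^(-1/2) because k - rho n is of order ln n,
    hence negligible with respect to sqrt n; the factor kappa^(k - rho n) is
    (beta n)^(1/2) kappa^z, by the choice of the centering.

    The estimates are proved along an arbitrary sequence k n staying at bounded
    distance from the centering; uniformity follows by applying them to a
    sequence of worst indices ([log_tail_err_unif]). *)

Local Open Scope classical_set_scope.
Local Open Scope ring_scope.

Set Implicit Arguments.
Unset Strict Implicit.
Unset Printing Implicit Defensive.

(** * Stirling's formula *)

(** A derivative known on the closed segment also supplies the continuity that the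
    mean value theorem asks for. *)
Lemma derive_ge0_le {R : realType} (f df : R -> R) (a b : R) : a <= b ->
    (forall x, a <= x <= b -> is_derive x 1 f (df x)) ->
    (forall x, a <= x <= b -> 0 <= df x) -> f a <= f b.
Proof.
move=> ab f_df df_ge0.
have [x|x|c] := @MVT_segment R f df a b ab.
- by rewrite in_itv /= => /andP[ax xb]; apply: f_df; rewrite !ltW.
- apply: derivable_within_continuous => y; rewrite in_itv /= => aby.
  by apply: ex_derive; exact: f_df.
rewrite in_itv /= => acb fab; rewrite -subr_ge0 fab.
by rewrite mulr_ge0 ?df_ge0// subr_ge0.
Qed.

(** Together with [ln_le_frac], this brackets ln y around y = 1 tightly enough
    (to third order in y - 1) to make the increments of [stirling_log]
    summable. *)
Lemma ln_ge_frac {R : realType} (y : R) : 1 <= y ->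
  2 * (y - 1) / (y + 1) <= ln y.
Proof.
move=> y1; rewrite -subr_ge0.
pose f := fun x : R => ln x - 2 * (x - 1) / (x + 1).
pose df := fun x : R => (x - 1) ^+ 2 / (x * (x + 1) ^+ 2).
suff : f 1 <= f y by rewrite /f ln1 subrr mulr0 mul0r subr0.
apply: (@derive_ge0_le _ f df) => // x /andP[x1 _]; last first.
  by rewrite /df divr_ge0 ?mulr_ge0 ?sqr_ge0//; lra.
have x0 : 0 < x by lra.
have x10 : x + 1 != 0 by lra.
have ? := is_derive1_ln x0.
rewrite /f; apply: is_derive_eq.
rewrite /df /GRing.scale /=.
by field; rewrite ?x10 ?gt_eqF.
Qed.

Lemma ln_le_frac {R : realType} (y : R) : 1 <= y ->
  ln y <= (y - y^-1) / 2.
Proof.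
move=> y1; rewrite -subr_ge0.
pose f := fun x : R => (x - x^-1) / 2 - ln x.
pose df := fun x : R => (x - 1) ^+ 2 / (2 * x ^+ 2).
suff : f 1 <= f y by rewrite /f ln1 invr1 subrr mul0r subr0.
apply: (@derive_ge0_le _ f df) => // x /andP[x1 _]; last first.
  by rewrite /df divr_ge0 ?mulr_ge0 ?sqr_ge0//; lra.
have x0 : 0 < x by lra.
have xn0 : x != 0 by lra.
have ? := is_derive1_ln x0.
have ? := @is_deriveV R id x 1 1 xn0 _.
rewrite /f; apply: is_derive_eq.
rewrite /df /GRing.scale /=.
by field; rewrite ?x10 ?gt_eqF.
Qed.

(** Logarithm of n! / (sqrt n (n / e)^n), the quantity whose limit is
    sqrt (2 pi) in Stirling's formula. *)
Definition stirling_log {R : realType} (n : nat) : R :=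
  ln n`!%:R - (n%:R + 1 / 2) * ln n%:R + n%:R.

Lemma stirling_log_step {R : realType} (n : nat) :
  stirling_log n.+1 - stirling_log n.+2 =
  (n%:R + 3 / 2) * ln (n.+2%:R / n.+1%:R) - 1 :> R.
Proof.
rewrite /stirling_log [n.+2`!]factS natrM.
rewrite lnM ?ln_div ?posrE ?ltr0n ?fact_gt0//.
rewrite -!(natr1 n.+1) -!(natr1 n).
by field.
Qed.

(** With y = (n+2)/(n+1) one has 2 (y-1)/(y+1) = 1 / (n + 3/2), so the lower
    bound of [ln_ge_frac] makes the increment exactly nonnegative. *)
Lemma stirling_log_decr {R : realType} (n : nat) :
  @stirling_log R n.+2 <= stirling_log n.+1.
Proof.
rewrite -subr_ge0 stirling_log_step subr_ge0.
have n0 : 0 <= n%:R :> R by [].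
have y1 : 1 <= n.+2%:R / n.+1%:R :> R.
  by rewrite ler_pdivlMr ?ltr0n// mul1r ler_nat.
have c0 : 0 <= n%:R + 3 / 2 :> R by lra.
have := ler_wpM2l c0 (ln_ge_frac y1); apply: le_trans.
rewrite -!(natr1 n.+1) -!(natr1 n).
rewrite le_eqVlt; apply/orP; left; apply/eqP.
by field; rewrite !gt_eqF//; lra.
Qed.

(** The correction 1/(4m) telescopes against the bound 1/(4m(m+1)) that
    [ln_le_frac] gives for a decrement; this provides a lower bound for the
    decreasing sequence [stirling_log]. *)
Lemma stirling_log_quarter_incr {R : realType} (n : nat) :
  @stirling_log R n.+1 - (4 * n.+1%:R)^-1
  <= stirling_log n.+2 - (4 * n.+2%:R)^-1.
Proof.
rewrite lerBlDr -lerBlDl opprB addrCA addrC -lerBrDr.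
have n0 : 0 <= n%:R :> R by [].
have y1 : 1 <= n.+2%:R / n.+1%:R :> R.
  by rewrite ler_pdivlMr ?ltr0n// mul1r ler_nat.
rewrite stirling_log_step lerBlDr.
have c0 : 0 <= n%:R + 3 / 2 :> R by lra.
have /le_trans := ler_wpM2l c0 (ln_le_frac y1); apply.
rewrite -!(natr1 n.+1) -!(natr1 n).
rewrite le_eqVlt; apply/orP; left; apply/eqP.
by field; rewrite !gt_eqF//; lra.
Qed.

Lemma stirling_log_cvg {R : realType} : cvgn (@stirling_log R).
Proof.
suff : cvgn (fun n => @stirling_log R n.+1).
  by move=> /cvg_ex[l sl]; apply/cvg_ex; exists l; rewrite -cvg_shiftS.
apply: nonincreasing_is_cvgn.
  by apply/nonincreasing_seqP => n; exact: stirling_log_decr.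
(* the value at m = 1 of the increasing sequence stirling_log m - 1/(4m) *)
exists (stirling_log 1 - 4^-1) => _ [n _ <-].
have : stirling_log 1 - (4 * 1)^-1 <= stirling_log n.+1 - (4 * n.+1%:R)^-1 :> R.
  elim: n => // n /le_trans; apply; exact: stirling_log_quarter_incr.
rewrite mulr1 => /le_trans; apply.
by rewrite lerBlDr lerDl invr_ge0.
Qed.

(** Explicit primitives of the powers of the sine, given by the reduction
    formula that integration by parts would produce.  They turn the Wallis
    integrals into differences of values. *)
Fixpoint sin_prim {R : realType} (n : nat) (x : R) : R :=
  match n with
  | 0 => x
  | 1 => - cos x
  | (m.+1 as n').+1 =>
      m.+1%:R / m.+2%:R * sin_prim m x - sin x ^+ m.+1 * cos x / m.+2%:R
  end.

Lemma is_derive_sin_prim {R : realType} (n : nat) (x : R) :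
  is_derive x 1 (sin_prim n) (sin x ^+ n).
Proof.
suff [] : is_derive x 1 (sin_prim n) (sin x ^+ n) /\
  is_derive x 1 (sin_prim n.+1) (sin x ^+ n.+1) by [].
elim: n => [|n [dF dF1]]; split; [exact: is_derive_id| |exact: dF1|].
  by rewrite /= expr1; apply: is_derive_eq; rewrite opprK.
have dS : is_derive x 1 (fun y : R => sin y ^+ n.+1)
    (n.+1%:R * sin x ^+ n * cos x).
  have := @is_deriveX R R sin n.+1 x 1 _ (is_derive_sin x).
  by rewrite /GRing.scale /= exprfctE.
have dC := is_derive_cos x.
have -> : sin_prim n.+2 = (n.+1%:R / n.+2%:R) \*: sin_prim n -
    n.+2%:R^-1 \*: ((fun y => sin y ^+ n.+1) * @cos R).
  apply/funext => y; rewrite !fctE /GRing.scale /=.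
  by rewrite [X in _ - X]mulrC.
apply: is_derive_eq; rewrite /GRing.scale /= !exprS.
have /eqP := cos2sin2 x; rewrite -subr_eq0 => /eqP cs.
have n0 : n.+2%:R != 0 :> R by [].
apply/eqP; rewrite -subr_eq0; apply/eqP.
(* the two sides differ by a multiple of cos^2 - (1 - sin^2) *)
rewrite -[RHS](mulr0 (- n.+1%:R * sin x ^+ n / n.+2%:R)) -cs.
by move: n0; rewrite -(natr1 n.+1); move=> n0; field.
Qed.

(** The Wallis integral of sin^n over [0, pi/2]. *)
Definition wallis_int {R : realType} (n : nat) : R :=
  sin_prim n (pi / 2) - sin_prim n 0.

Lemma wallis_int0 {R : realType} : @wallis_int R 0 = pi / 2.
Proof. by rewrite /wallis_int /= subr0. Qed.

Lemma wallis_int1 {R : realType} : @wallis_int R 1 = 1.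
Proof. by rewrite /wallis_int /= cos_pihalf cos0 oppr0 opprK add0r. Qed.

Lemma wallis_intSS {R : realType} (n : nat) :
  @wallis_int R n.+2 = n.+1%:R / n.+2%:R * wallis_int n.
Proof.
rewrite /wallis_int /= cos_pihalf sin0 expr0n /= !(mulr0, mul0r, subr0).
by rewrite mulrBr.
Qed.

(** sin^(n+1) <= sin^n on [0, pi/2], and integrals are monotone: the difference
    of the two primitives has a nonnegative derivative there. *)
Lemma wallis_int_decr {R : realType} (n : nat) :
  @wallis_int R n.+1 <= wallis_int n.
Proof.
pose f := fun x : R => sin_prim n x - sin_prim n.+1 x.
pose df := fun x : R => sin x ^+ n - sin x ^+ n.+1.
suff : f 0 <= f (pi / 2) by rewrite /wallis_int /f; lra.
apply: (@derive_ge0_le _ f df) => [|x _|x /andP[x0 xpi]].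
- by rewrite divr_ge0 ?pi_ge0.
- have ? := is_derive_sin_prim n x; have ? := is_derive_sin_prim n.+1 x.
  by rewrite /f; apply: is_derive_eq.
- have s0 : 0 <= sin x by apply: sin_ge0_pi; rewrite x0 /=; have := @pi_ge0 R; lra.
  by rewrite /df exprS subr_ge0 ler_piMl ?exprn_ge0 ?sin_le1.
Qed.

(** The central binomial coefficient 'C(2n, n) divided by 4^n. *)
Definition central_ratio {R : realType} (n : nat) : R :=
  (2 * n)`!%:R / (4 ^+ n * n`!%:R ^+ 2).

Lemma central_ratio_gt0 {R : realType} (n : nat) : 0 < @central_ratio R n.
Proof. by rewrite divr_gt0 ?mulr_gt0 ?exprn_gt0 ?ltr0n ?fact_gt0. Qed.

Lemma central_ratio0 {R : realType} : @central_ratio R 0 = 1.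
Proof. by rewrite /central_ratio muln0 fact0 expr0 expr1n mulr1 divr1. Qed.

Lemma central_ratioS {R : realType} (n : nat) :
  @central_ratio R n.+1 = (2 * n).+1%:R / (2 * n).+2%:R * central_ratio n.
Proof.
rewrite /central_ratio mulnS !factS !natrM exprS.
have n0 : n`!%:R != 0 :> R by rewrite pnatr_eq0 -lt0n fact_gt0.
have N0 : 4 ^+ n != 0 :> R by rewrite expf_neq0.
have n1 : 2 * n%:R + 1 + 1 != 0 :> R by have : 0 <= n%:R :> R by []; lra.
have n2 : n%:R + 1 != 0 :> R by have : 0 <= n%:R :> R by []; lra.
rewrite -!natr1 natrM; field.
by rewrite n0 n1 n2 andbT expf_neq0//; lra.
Qed.

Lemma wallis_int_even {R : realType} (n : nat) :
  wallis_int (2 * n) = pi / 2 * central_ratio n :> R.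
Proof.
elim: n => [|n IHn].
  by rewrite muln0 wallis_int0 central_ratio0 mulr1.
by rewrite central_ratioS mulnS wallis_intSS IHn mulrCA.
Qed.

Lemma wallis_int_odd {R : realType} (n : nat) :
  wallis_int (2 * n).+1 = ((2 * n).+1%:R * central_ratio n)^-1 :> R.
Proof.
elim: n => [|n IHn].
  by rewrite muln0 wallis_int1 central_ratio0 mulr1 invr1.
rewrite central_ratioS mulnS wallis_intSS IHn.
move: (2 * n)%N (central_ratio n) (@central_ratio_gt0 R n) => m w w0.
by field; rewrite gt_eqF//= -?(natr1 m) -?(natr1 m.+1) -?(natr1 m.+2) !gt_eqF.
Qed.

(** Wallis' product, in logarithmic form: the even and odd Wallis integrals are
    pi/2 w and 1/((2n+1) w) with w the central ratio, and their monotonicity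
    squeezes (2n+1) w^2 pi/2 between 1 and 1 + 1/(2n+1). *)
Lemma central_ratio_bounds {R : realType} (n : nat) :
  0 <= ln (2 * n).+1%:R + 2 * ln (@central_ratio R n) + ln (pi / 2)
    <= (2 * n).+1%:R^-1.
Proof.
have [m mE] : exists m : R, m = (2 * n).+1%:R by exists (2 * n).+1%:R.
rewrite -mE.
have m0 : 0 < m by rewrite mE.
have pi0 : 0 < pi / 2 :> R by rewrite divr_gt0 ?pi_gt0.
have w0 := @central_ratio_gt0 R n.
have := @wallis_int_decr R (2 * n); have := @wallis_int_decr R (2 * n).+1.
rewrite wallis_intSS wallis_int_even wallis_int_odd -[(2 * n).+2%:R]natr1 -mE.
move: (central_ratio n) (pi / 2) w0 pi0 => w P w0 P0 up lo.
have mw0 : 0 < m * w by rewrite mulr_gt0.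
have -> : ln m + 2 * ln w + ln P = ln (P * w * (m * w)).
  rewrite lnM ?posrE ?mulr_gt0// lnM ?posrE// [ln (m * w)]lnM ?posrE//; ring.
apply/andP; split; first by rewrite ln_ge0// -ler_pdivrMr// mul1r.
have {}up : P * w * (m * w) <= 1 + m^-1.
  have -> : 1 + m^-1 = (m * w)^-1 * ((m + 1) / m * (m * w)).
    by field; rewrite !gt_eqF.
  have -> : P * w * (m * w) =
      (m / (m + 1) * (P * w)) * ((m + 1) / m * (m * w)).
    by field; rewrite !gt_eqF//; lra.
  by rewrite ler_pM2r// mulr_gt0// divr_gt0//; lra.
have mV0 : 0 < m^-1 by rewrite invr_gt0.
apply: le_trans (_ : ln (1 + m^-1) <= _); last by rewrite le_ln1Dx//; lra.
by rewrite ler_ln ?posrE ?mulr_gt0//; lra.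
Qed.

(** In 2 n and n the powers of n and e cancel, so the limit l of [stirling_log],
    known to exist, satisfies an equation 2 (l - 2 l) = - ln (2 pi) read off from
    the central binomial coefficient. *)
Lemma stirling_log_double {R : realType} (n : nat) :
  2 * (stirling_log (2 * n.+1) - 2 * stirling_log n.+1) =
  2 * ln (central_ratio n.+1) + ln n.+1%:R - ln 2 :> R.
Proof.
rewrite /stirling_log /central_ratio.
move: (fact_gt0 (2 * n.+1)) (fact_gt0 n.+1).
move: (2 * n.+1)`! (n.+1)`! => F f F0 f0.
rewrite ln_div ?posrE ?mulr_gt0 ?exprn_gt0 ?ltr0n//.
rewrite lnM ?posrE ?exprn_gt0 ?ltr0n//.
rewrite !lnXn ?ltr0n// natrM lnM ?posrE ?ltr0n//.
have -> : ln 4 = 2 * ln 2 :> R.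
  by rewrite (_ : 4 = 2 ^+ 2) ?lnXn ?mulr_natl//; ring.
rewrite -[(2 * ln 2) *+ n.+1]mulr_natl -[ln f%:R *+ 2]mulr_natl.
move: (ln n.+1%:R) => c; move: (ln F%:R) (ln f%:R) (ln 2) n.+1%:R.
by move=> *; field.
Qed.

Lemma stirling_log_double_bound {R : realType} (n : nat) :
  `|2 * (stirling_log (2 * n.+1) - 2 * stirling_log n.+1) + ln (2 * pi)|
  <= n.+1%:R^-1 :> R.
Proof.
have a0 : 0 < n.+1%:R :> R by [].
have /andP[lo up] := @central_ratio_bounds R n.+1.
have b0 : 0 < (2 * n.+1%:R)^-1 :> R by rewrite invr_gt0 mulr_gt0.
have lo' : 0 <= ln (1 + (2 * n.+1%:R)^-1) :> R by rewrite ln_ge0// lerDl ltW.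
have up' : ln (1 + (2 * n.+1%:R)^-1) <= (2 * n.+1%:R)^-1 :> R.
  by rewrite le_ln1Dx// (lt_trans _ b0)// ltrN10.
have E : (2 * n.+1).+1%:R = 2 * n.+1%:R * (1 + (2 * n.+1%:R)^-1) :> R.
  by rewrite -natr1 natrM mulrDr mulr1 divff// mulf_neq0.
have lE : ln (2 * n.+1).+1%:R = ln 2 + ln n.+1%:R + ln (1 + (2 * n.+1%:R)^-1) :> R.
  have c0 : 0 < 1 + (2 * n.+1%:R)^-1 :> R by rewrite addr_gt0.
  by rewrite E lnM ?posrE ?mulr_gt0// lnM ?posrE.
rewrite stirling_log_double.
have up2 : (2 * n.+1).+1%:R^-1 <= n.+1%:R^-1 :> R.
  by rewrite lef_pV2 ?posrE// ler_nat ltnW// ltnS leq_pmull.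
have up3 : (2 * n.+1%:R)^-1 <= n.+1%:R^-1 :> R.
  by rewrite lef_pV2 ?posrE ?mulr_gt0// -natrM ler_nat leq_pmull.
have lnpi2 : ln (pi / 2) = ln pi - ln 2 :> R by rewrite ln_div ?posrE ?pi_gt0.
have ln2pi : ln (2 * pi) = ln 2 + ln pi :> R by rewrite lnM ?posrE ?pi_gt0.
move: lo up up2 up3 lo' up'; rewrite lE lnpi2 ln2pi.
move: (ln (1 + (2 * n.+1%:R)^-1)) (ln (central_ratio _)) => a b.
move: (ln n.+1%:R) (ln 2) (ln pi) (2 * n.+1).+1%:R^-1 (2 * n.+1%:R)^-1 n.+1%:R^-1.
move=> c d e f g h lo up up2 up3 lo' up'.
by rewrite ler_norml; apply/andP; split; lra.
Qed.

Lemma stirling_log_lim {R : realType} :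
  @stirling_log R n @[n --> \oo] --> ln (2 * pi) / 2.
Proof.
have /cvg_ex[/= l sl] := @stirling_log_cvg R.
suff -> : ln (2 * pi) / 2 = l by [].
have s2 : stirling_log (2 * n.+1) @[n --> \oo] --> l.
  apply: (cvg_comp (fun n => (2 * n.+1)%N)) sl.
  apply/cvgnyPge => A; near=> n.
  by rewrite (@leq_trans n)//; [near: n; exact: nbhs_infty_ge|lia].
have s1 : stirling_log n.+1 @[n --> \oo] --> l by rewrite cvg_shiftS.
have c1 : 2 * (stirling_log (2 * n.+1) - 2 * stirling_log n.+1) + ln (2 * pi)
    @[n --> \oo] --> 2 * (l - 2 * l) + ln (2 * pi).
  by apply: cvgD; [apply: cvgMr; apply: cvgB => //; exact: cvgMr|exact: cvg_cst].
have c0 : 2 * (stirling_log (2 * n.+1) - 2 * stirling_log n.+1) + ln (2 * pi)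
    @[n --> \oo] --> (0 : R).
  apply/norm_cvg0P; apply: squeeze_cvgr (cvg_cst _) cvg_harmonic.
  by near=> n; rewrite normr_ge0; exact: stirling_log_double_bound.
have : 2 * (l - 2 * l) + ln (2 * pi) = 0.
  exact: (cvg_unique _ c1 c0).
move: (ln (2 * pi)) => a E; have -> : a = 2 * l by lra.
by field.
Unshelve. all: by end_near. Qed.

Lemma ln_fact {R : realType} (m : nat) :
  ln m`!%:R = stirling_log m + (m%:R + 1 / 2) * ln m%:R - m%:R :> R.
Proof. by rewrite /stirling_log; ring. Qed.

(** * Tail of the binomial distribution *)

Section binomial_tail.
Context {R : realType}.
Variables (p : R) (n : nat).
Hypothesis hp : 0 < p < 1.

Definition binom_mass (j : nat) : R := 'C(n, j)%:R * p ^+ j * (1 - p) ^+ (n - j).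

Definition binom_tail (k : nat) : R := \sum_(k <= j < n.+1) binom_mass j.

(** The expected overshoot E (S - k)^+ of a binomial variable S above k. *)
Definition binom_excess (k : nat) : R :=
  \sum_(k <= j < n.+1) (j - k)%:R * binom_mass j.

Lemma binom_mass_ge0 j : 0 <= binom_mass j.
Proof. by case/andP: hp => p0 p1; rewrite /binom_mass !mulr_ge0 ?exprn_ge0//; lra. Qed.

Lemma binom_mass_gt0 j : (j <= n)%N -> 0 < binom_mass j.
Proof.
case/andP: hp => p0 p1 jn.
by rewrite /binom_mass !mulr_gt0 ?exprn_gt0 ?ltr0n ?bin_gt0//; lra.
Qed.

Lemma binom_mass_step j :
  j.+1%:R * (1 - p) * binom_mass j.+1 = (n - j)%:R * p * binom_mass j.
Proof.
rewrite /binom_mass; have [jn|nj] := ltnP j n; last first.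
  by rewrite bin_small// (eqP nj) !(mul0r, mulr0).
have cE : j.+1%:R * 'C(n, j.+1)%:R = (n - j)%:R * 'C(n, j)%:R :> R.
  by rewrite -!natrM mul_bin_left.
have qE : (1 - p) ^+ (n - j) = (1 - p) * (1 - p) ^+ (n - j.+1).
  by rewrite -exprS subnSK.
transitivity (j.+1%:R * 'C(n, j.+1)%:R * (p * p ^+ j) *
    ((1 - p) * (1 - p) ^+ (n - j.+1))); first by rewrite exprS; ring.
by rewrite cE qE; ring.
Qed.

(** The index n.+1 produced by the shift contributes nothing because
    'C(n, n.+1) = 0. *)
Lemma sum_binom_mass_shift (f : nat -> R) k : (k <= n)%N ->
  \sum_(k <= j < n.+1) f j.+1 * binom_mass j.+1 =
  \sum_(k <= j < n.+1) f j * binom_mass j - f k * binom_mass k.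
Proof.
move=> kn; rewrite -[n.+1 in LHS]/(n.+2.-1).
rewrite -(@big_add1 _ _ _ k n.+2 xpredT (fun j => f j * binom_mass j)).
rewrite big_nat_recr//= [in RHS]big_ltn// [binom_mass n.+1]/binom_mass bin_small//.
ring.
Qed.

(** Summing [binom_mass_step] over j >= k: the left-hand side is a shifted sum of
    j b j, the right-hand side a sum of (n - j) p b j, and both are affine in the
    tail and the excess once j is written k + (j - k). *)
Lemma binom_tail_excess k : (k <= n)%N ->
  (k%:R - p * n%:R) * binom_tail k + binom_excess k =
  (1 - p) * k%:R * binom_mass k.
Proof.
move=> kn.
have sumE (a b : R) : \sum_(k <= j < n.+1) (a + b * (j - k)%:R) * binom_mass j =
    a * binom_tail k + b * binom_excess k.
  rewrite /binom_tail /binom_excess !mulr_sumr -big_split /=.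
  by apply: eq_bigr => j _; ring.
have L : \sum_(k <= j < n.+1) j%:R * binom_mass j =
    k%:R * binom_tail k + binom_excess k.
  rewrite -[binom_excess k]mul1r -sumE; apply: eq_big_nat => j /andP[kj _].
  by rewrite natrB//; congr (_ * _); ring.
have Rs : \sum_(k <= j < n.+1) (n - j)%:R * binom_mass j =
    (n%:R - k%:R) * binom_tail k - binom_excess k.
  rewrite -[binom_excess k]mul1r -mulNr -sumE; apply: eq_big_nat => j /andP[kj jn].
  by rewrite !natrB//; congr (_ * _); ring.
have := sum_binom_mass_shift (fun j => j%:R) kn.
rewrite L => sh.
have : (1 - p) * \sum_(k <= j < n.+1) j.+1%:R * binom_mass j.+1 =
    p * \sum_(k <= j < n.+1) (n - j)%:R * binom_mass j.
  rewrite !mulr_sumr; apply: eq_bigr => j _.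
  by rewrite mulrCA mulrA binom_mass_step -mulrA mulrCA.
rewrite sh Rs.
move: (binom_tail k) (binom_excess k) (binom_mass k) k%:R n%:R => Q V b x y e.
apply/eqP; rewrite -subr_eq0; apply/eqP.
transitivity ((1 - p) * (x * Q + V - x * b) - p * ((y - x) * Q - V)); first by ring.
by rewrite e subrr.
Qed.

Lemma binom_excess_ge0 k : 0 <= binom_excess k.
Proof. by apply: sumr_ge0 => j _; rewrite mulr_ge0 ?binom_mass_ge0. Qed.

Lemma binom_tail_ge0 k : 0 <= binom_tail k.
Proof. by apply: sumr_ge0 => j _; rewrite binom_mass_ge0. Qed.

(** Multiplying [binom_mass_step] by j + 1 - k before summing, and bounding the
    factors j + 1 >= k + 1 and n - j <= n - k, gives
    (k+1) q V <= (n-k) p (V + Q) for the excess V and the tail Q. *)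
Lemma binom_excess_le k : (k <= n)%N ->
  (k%:R - p * n%:R) * binom_excess k <= p * n%:R * binom_tail k.
Proof.
move=> kn; case/andP: (hp) => p0 p1.
have shV : \sum_(k <= j < n.+1) (j.+1 - k)%:R * binom_mass j.+1 = binom_excess k.
  by rewrite (sum_binom_mass_shift (fun j => (j - k)%:R) kn) subnn mul0r subr0.
have shQ : \sum_(k <= j < n.+1) (j.+1 - k)%:R * binom_mass j =
    binom_excess k + binom_tail k.
  rewrite /binom_tail /binom_excess -big_split /=; apply: eq_big_nat => j /andP[kj _].
  by rewrite subSn// -natr1; ring.
have : k.+1%:R * (1 - p) * binom_excess k <=
    (n%:R - k%:R) * p * (binom_excess k + binom_tail k).
  rewrite -shQ -[X in _ * X <= _]shV !mulr_sumr.
  apply: ler_sum_nat => j /andP[kj jn].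
  rewrite mulrCA [leRHS]mulrCA ler_wpM2l//.
  apply: le_trans (_ : j.+1%:R * (1 - p) * binom_mass j.+1 <= _).
    rewrite ler_wpM2r ?binom_mass_ge0// ler_wpM2r; [by []|lra|by rewrite ler_nat].
  rewrite binom_mass_step ler_wpM2r ?binom_mass_ge0// ler_wpM2r; [by []|lra|].
  by rewrite natrB// lerB ?ler_nat.
have := binom_excess_ge0 k; have := binom_tail_ge0 k.
have k0 : 0 <= k%:R :> R by [].
move: k0; rewrite -(natr1 k).
move: (binom_tail k) (binom_excess k) k%:R n%:R => Q V x y x0 Q0 V0 h.
have pV : 0 <= (1 - p) * V by rewrite mulr_ge0//; lra.
have xQ : 0 <= x * p * Q by rewrite !mulr_ge0//; lra.
rewrite -subr_ge0.
have -> : p * y * Q - (x - p * y) * V =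
  ((y - x) * p * (V + Q) - (x + 1) * (1 - p) * V) + (1 - p) * V + x * p * Q by ring.
by apply: addr_ge0 => //; apply: addr_ge0 => //; rewrite subr_ge0.
Qed.

End binomial_tail.

Lemma sum_binom_mass {R : realType} (p : R) (n : nat) :
  \sum_(0 <= j < n.+1) binom_mass p n j = 1.
Proof.
rewrite big_mkord -(expr1n R n) -(subrK p 1) exprDn.
by apply: eq_bigr => j _; rewrite /binom_mass -mulrA mulr_natl mulrC.
Qed.

(** * The constants of the centering *)

Section rate.
Context {R : realType}.
Variable p : R.
Hypothesis hp : 0 < p < 1 / 2.

(** ln 2 - D(x || p), with D the relative entropy of the Bernoulli laws of
    parameters x and p: for x >= p, the exponential growth rate
    of 2^n P(S_n >= x n). *)
Definition rate_gap (x : R) : R :=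
  ln 2 + x * ln p + (1 - x) * ln (1 - p) - x * ln x - (1 - x) * ln (1 - x).

Lemma rate_gap_eq0 (x : R) : 0 < x < 1 ->
  (2 * p `^ x * (1 - p) `^ (1 - x) = x `^ x * (1 - x) `^ (1 - x)) <->
  rate_gap x = 0.
Proof.
move=> /andP[x0 x1]; case/andP: hp => p0 p1.
have q0 : 0 < 1 - p by lra.
have y0 : 0 < 1 - x by lra.
have LE : ln (2 * p `^ x * (1 - p) `^ (1 - x)) =
    ln 2 + x * ln p + (1 - x) * ln (1 - p).
  by rewrite !lnM ?posrE ?mulr_gt0 ?powR_gt0// !ln_powR.
have RE : ln (x `^ x * (1 - x) `^ (1 - x)) = x * ln x + (1 - x) * ln (1 - x).
  by rewrite lnM ?posrE ?powR_gt0// !ln_powR.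
split=> [E|E].
  by move: (congr1 (@ln R) E); rewrite LE RE /rate_gap => {}E; lra.
apply: ln_inj; rewrite ?posrE ?mulr_gt0 ?powR_gt0//.
by rewrite LE RE; move: E; rewrite /rate_gap => E; lra.
Qed.

(** It suffices that ln (2 (1 - p)) > 0, i.e. p < 1/2; the remaining terms are
    nonnegative for x <= p.  This places every root to the right of p. *)
Lemma rate_gap_gt0 (x : R) : 0 < x <= p -> 0 < rate_gap x.
Proof.
move=> /andP[x0 xp]; case/andP: hp => p0 p1.
have q0 : 0 < 1 - p by lra.
have y0 : 0 < 1 - x by lra.
have lxp : 0 <= ln p - ln x by rewrite subr_ge0 ler_ln ?posrE.
have l1 : ln (1 - x) <= 0 by rewrite ln_le0//; lra.
have l2 : 0 < ln 2 + ln (1 - p).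
  by rewrite -lnM ?posrE//; apply: ln_gt0; lra.
have lq : ln (1 - p) <= 0 by rewrite ln_le0//; lra.
have e1 : 0 <= x * (ln p - ln x) by rewrite mulr_ge0// ltW.
have e2 : 0 <= (1 - x) * - ln (1 - x) by rewrite mulr_ge0 ?oppr_ge0// ltW.
have e3 : 0 <= x * - ln (1 - p) by rewrite mulr_ge0 ?oppr_ge0// ltW.
have -> : rate_gap x = x * (ln p - ln x) + (1 - x) * - ln (1 - x) +
    x * - ln (1 - p) + (ln 2 + ln (1 - p)) by rewrite /rate_gap; ring.
lra.
Qed.

(** As x tends to 1 the gap tends to ln (2 p) < 0.  The point 1 - s^2 makes this
    quantitative: of the two entropy terms one is at most s^2, the other, equal
    to s^2 |ln (s^2)|, at most 2 s. *)
Lemma rate_gap_lt0 : exists2 x, p < x < 1 & rate_gap x < 0.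
Proof.
case/andP: hp => p0 p1.
have q0 : 0 < 1 - p by lra.
pose a := - ln (2 * p); pose C := ln (1 - p) - ln p.
have a0 : 0 < a by rewrite oppr_gt0; apply: ln_lt0; apply/andP; split; lra.
have C0 : 0 <= C by rewrite subr_ge0 ler_ln ?posrE//; lra.
(* s is small enough for s (C + 3) < a, where the gap at 1 - s^2 is at most
   - a + s (C + 3), and for s < 1/2, so that 1 - s^2 > 3/4 > p *)
pose s := a / (C + 3 + 2 * a).
have d0 : 0 < C + 3 + 2 * a by lra.
have s0 : 0 < s by rewrite divr_gt0.
have s1 : s < 1 / 2 by rewrite ltr_pdivrMr//; lra.
have sC : s * (C + 3) < a.
  by rewrite mulrAC ltr_pdivrMr// ltr_pM2l//; lra.
clearbody s.
have ss : s * s <= s / 2 by rewrite ler_pM2l//; lra.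
have ss0 : 0 < s * s by rewrite mulr_gt0.
exists (1 - s * s); first by apply/andP; split; lra.
set e := s * s in ss ss0 *.
have w0 : 0 < 1 - e by lra.
have l1 : - ((1 - e) * ln (1 - e)) <= e.
  have -> : - ((1 - e) * ln (1 - e)) = (1 - e) * ln (1 - e)^-1.
    by rewrite lnV ?posrE// mulrN.
  have -> : (1 - e)^-1 = 1 + e / (1 - e) by field; rewrite gt_eqF.
  have w1 : 0 < e / (1 - e) by rewrite divr_gt0.
  apply: le_trans (_ : (1 - e) * (e / (1 - e)) <= _); last first.
    by rewrite mulrCA divff ?mulr1// gt_eqF.
  by rewrite ler_pM2l// le_ln1Dx//; lra.
have l2 : - (e * ln e) <= 2 * s.
  have -> : - (e * ln e) = (2 * s) * (s * ln s^-1).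
    by rewrite /e lnM ?posrE// lnV ?posrE//; ring.
  apply: ler_piMr; first by lra.
  apply: le_trans (_ : s * s^-1 <= _); last by rewrite divff ?gt_eqF//.
  by rewrite ler_pM2l// ltW// ln_sublinear// invr_gt0.
have aE : ln 2 + ln p = - a by rewrite /a opprK lnM ?posrE.
have eC : e * C <= s * C.
  by rewrite ler_wpM2r//; lra.
have eE : (1 - (1 - e)) = e by ring.
rewrite /rate_gap eE.
have -> : ln 2 + (1 - e) * ln p + e * ln (1 - p) - (1 - e) * ln (1 - e) - e * ln e
  = (ln 2 + ln p) + e * C - ((1 - e) * ln (1 - e)) - e * ln e by rewrite /C; ring.
rewrite aE; lra.
Qed.

Lemma rate_gap_root : exists x : R, 0 < x < 1 /\
  2 * p `^ x * (1 - p) `^ (1 - x) = x `^ x * (1 - x) `^ (1 - x).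
Proof.
case/andP: hp => p0 p1.
have [b /andP[pb b1] gb] := rate_gap_lt0.
have [||c] := @IVT R rate_gap p b 0 (ltW pb).
- apply: continuous_in_subspaceT => x; rewrite inE /= in_itv /= => /andP[px xb].
  have x0 : 0 < x by lra.
  have y0 : 0 < 1 - x by lra.
  have cl : ln y @[y --> x] --> ln x by exact: continuous_ln.
  have c1 : 1 - y @[y --> x] --> 1 - x by apply: cvgB; [exact: cvg_cst|exact: cvg_id].
  have cl1 : ln (1 - y) @[y --> x] --> ln (1 - x).
    exact: cvg_comp c1 (continuous_ln y0).
  rewrite /continuous_at /rate_gap.
  apply: cvgB; last exact: cvgM.
  apply: cvgB; last by apply: cvgM => //; exact: cvg_id.
  apply: cvgD; last exact: cvgMl.
  apply: cvgD; first exact: cvg_cst.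
  by apply: cvgMl; exact: cvg_id.
- have gp : 0 < rate_gap p by apply: rate_gap_gt0; rewrite p0 lexx.
  by rewrite ge_min le_max (ltW gp) (ltW gb) orbT.
rewrite in_itv /= => /andP[pc cb] gc.
have c01 : 0 < c < 1 by apply/andP; split; lra.
by exists c; split => //; apply/rate_gap_eq0.
Qed.

Lemma rho_star_itv : 0 < rho_star p < 1.
Proof.
rewrite /rho_star; case: xgetP => [_ -> []//|h].
by have [x hx] := rate_gap_root; case: (h x).
Qed.

Lemma rho_star_rate : rate_gap (rho_star p) = 0.
Proof.
apply/(rate_gap_eq0 rho_star_itv); rewrite /rho_star.
case: xgetP => [_ -> []//|h].
by have [x hx] := rate_gap_root; case: (h x).
Qed.

Lemma rho_star_gt : p < rho_star p.
Proof.
rewrite ltNge; apply/negP => h; case/andP: rho_star_itv => r0 r1.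
by have := @rate_gap_gt0 (rho_star p); rewrite rho_star_rate ltxx r0 h => /(_ isT).
Qed.

Lemma kappa_gt0 : 0 < kappa p.
Proof.
case/andP: hp => p0 p1; case/andP: rho_star_itv => r0 r1.
by rewrite /kappa divr_gt0// mulr_gt0//; lra.
Qed.

(** Equivalent to p < rho_star. *)
Lemma kappa_lt1 : kappa p < 1.
Proof.
case/andP: hp => p0 p1; case/andP: rho_star_itv => r0 r1.
have q0 : 0 < 1 - p by lra.
rewrite /kappa ltr_pdivrMr ?mulr_gt0// mul1r; have := rho_star_gt; lra.
Qed.

Lemma beta_gt0 : 0 < beta p.
Proof.
case/andP: rho_star_itv => r0 r1.
by rewrite /beta !mulr_gt0 ?pi_gt0 ?subr_gt0.
Qed.

Lemma ln_kappa : ln (kappa p) =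
  ln p + ln (1 - rho_star p) - ln (1 - p) - ln (rho_star p).
Proof.
case/andP: hp => p0 p1; case/andP: rho_star_itv => r0 r1.
rewrite /kappa ln_div ?lnM ?posrE ?mulr_gt0//; lra.
Qed.

End rate.

(** * Asymptotics of the upper tail at the centering *)

Lemma natV_cvg0 {R : realType} : n%:R^-1 @[n --> \oo] --> (0 : R).
Proof. by rewrite -cvg_shiftS; exact: cvg_harmonic. Qed.

Lemma sqrt_natV_cvg0 {R : realType} : Num.sqrt (n%:R^-1) @[n --> \oo] --> (0 : R).
Proof.
rewrite -[X in _ --> X]sqrtr0.
exact: cvg_comp natV_cvg0 (@sqrt_continuous _ _).
Qed.

Lemma sqrt_sqrt_natV_cvg0 {R : realType} :
  Num.sqrt (Num.sqrt (n%:R^-1)) @[n --> \oo] --> (0 : R).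
Proof.
rewrite -[X in _ --> X]sqrtr0.
exact: cvg_comp sqrt_natV_cvg0 (@sqrt_continuous _ _).
Qed.

(** ln n <= 4 n^(1/4), that is ln y <= y at y = n^(1/4). *)
Lemma ln_nat_le {R : realType} (n : nat) : (0 < n)%N ->
  ln n%:R * Num.sqrt (n%:R^-1) <= 4 * Num.sqrt (Num.sqrt (n%:R^-1)) :> R.
Proof.
move=> n0; have v0 : 0 < n%:R^-1 :> R by rewrite invr_gt0 ltr0n.
have -> : ln n%:R = - ln n%:R^-1 :> R by rewrite lnV ?opprK ?posrE ?ltr0n.
move: n%:R^-1 v0 => v v0.
have key (t : R) : 0 < t -> - ln (t ^+ 4) * t ^+ 2 <= 4 * t.
  move=> t0; have lE : ln (t ^+ 4) = 4 * ln t by rewrite lnXn// mulr_natl.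
  rewrite lE -mulrN -lnV ?posrE// -mulrA ler_pM2l//.
  have tE : t = t^-1 * t ^+ 2 by rewrite expr2 mulrA mulVf ?mul1r// gt_eqF.
  rewrite [leRHS]tE.
  by rewrite ler_wpM2r ?sqr_ge0// ltW// ln_sublinear// invr_gt0.
have t0 : 0 < Num.sqrt (Num.sqrt v) by rewrite !sqrtr_gt0.
have sE : Num.sqrt (Num.sqrt v) ^+ 2 = Num.sqrt v by rewrite sqr_sqrtr.
have vE : Num.sqrt (Num.sqrt v) ^+ 4 = v.
  by rewrite (exprM _ 2 2) sE sqr_sqrtr// ltW.
by have := key _ t0; rewrite vE sE.
Qed.

Lemma ln_cvg0 {R : realType} (u : nat -> R) : u n @[n --> \oo] --> (1 : R) ->
  ln (u n) @[n --> \oo] --> (0 : R).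
Proof.
move=> u1; rewrite -[X in _ --> X]ln1.
by apply: cvg_comp u1 (continuous_ln _).
Qed.

Section local_limit.
Context {R : realType}.
Variables (p : R) (k : nat -> nat) (C : R).
Hypothesis hp : 0 < p < 1 / 2.
Hypothesis hk : \forall n \near \oo, `|(k n)%:R - centering p n| <= C.

Let rho := rho_star p.
Let kap := kappa p.
Let z n : R := (k n)%:R - centering p n.
Let x n : R := (k n)%:R - rho * n%:R.

Let rho0 : 0 < rho. Proof. by case/andP: (rho_star_itv hp). Qed.
Let rho1 : 0 < 1 - rho. Proof. by rewrite subr_gt0; case/andP: (rho_star_itv hp). Qed.
Let kap0 : 0 < kap := kappa_gt0 hp.
Let lnkap : ln kap < 0.
Proof. by apply: ln_lt0; rewrite kappa_gt0//= kappa_lt1. Qed.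

(** The deviation x is a bounded term plus a multiple of ln n, hence
    o(sqrt n): it lies below the Gaussian scale. *)
Lemma scaled_dev_cvg0 : x n * Num.sqrt (n%:R^-1) @[n --> \oo] --> (0 : R).
Proof.
pose D := (2 * `|ln kap|)^-1.
have D0 : 0 < D by rewrite invr_gt0 mulr_gt0// normr_gt0 lt_eqF.
pose A := C + `|ln (beta p)| * D.
apply/norm_cvg0P.
apply: (@squeeze_cvgr _ _ _ _ (fun=> 0)
    (fun n => A * Num.sqrt (n%:R^-1) + D * (4 * Num.sqrt (Num.sqrt (n%:R^-1))))).
- near=> n; rewrite normr_ge0 /=.
  have n0 : (0 < n)%N by near: n; exact: nbhs_infty_gt.
  have n0' : 0 < n%:R :> R by rewrite ltr0n.
  have b0 := beta_gt0 hp.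
  rewrite normrM [`|Num.sqrt _|]ger0_norm ?sqrtr_ge0//.
  have ln0 : 0 <= ln n%:R :> R by rewrite ln_ge0// ler1n.
  have xE : x n = z n - ln (beta p) * D - ln n%:R * D.
    rewrite /x /z /centering lnM ?posrE// -/rho -/kap -/D; ring.
  have : `|x n| <= A + D * ln n%:R.
    rewrite xE; apply: le_trans (ler_normB _ _) _; apply: lerD; last first.
      by rewrite mulrC ger0_norm// mulr_ge0// ltW.
    apply: le_trans (ler_normB _ _) _; rewrite lerD//.
      by near: n.
    by rewrite normrM [`|D|]gtr0_norm.
  move=> /(ler_wpM2r (sqrtr_ge0 n%:R^-1)) /le_trans; apply.
  by rewrite mulrDl lerD// -mulrA ler_pM2l// ln_nat_le.
- exact: cvg_cst.
- have -> : 0 = A * 0 + D * (4 * 0) :> R by rewrite !mulr0 addr0.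
  apply: cvgD; apply: cvgMr; first exact: sqrt_natV_cvg0.
  by apply: cvgMr; exact: sqrt_sqrt_natV_cvg0.
Unshelve. all: by end_near. Qed.

Lemma sqr_dev_cvg0 : x n ^+ 2 / n%:R @[n --> \oo] --> (0 : R).
Proof.
have -> : (fun n => x n ^+ 2 / n%:R) =
    (fun n => (x n * Num.sqrt (n%:R^-1)) * (x n * Num.sqrt (n%:R^-1))).
  by apply/funext => n; rewrite mulrACA -!expr2 sqr_sqrtr ?invr_ge0.
by rewrite -[X in _ --> X](mulr0 0); apply: cvgM; exact: scaled_dev_cvg0.
Qed.

Lemma ratio_cvg : (k n)%:R / n%:R @[n --> \oo] --> rho.
Proof.
have H : rho + (x n * Num.sqrt (n%:R^-1)) * Num.sqrt (n%:R^-1) @[n --> \oo] --> rho.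
  rewrite -[X in _ --> X]addr0 -[X in _ + X](mulr0 0).
  apply: cvgD; first exact: cvg_cst.
  by apply: cvgM; [exact: scaled_dev_cvg0|exact: sqrt_natV_cvg0].
apply: cvg_trans H; apply: near_eq_cvg; near=> n.
have n0 : n%:R != 0 :> R by rewrite pnatr_eq0 -lt0n; near: n; exact: nbhs_infty_gt.
by rewrite -mulrA -expr2 sqr_sqrtr ?invr_ge0// /x; field.
Unshelve. all: by end_near. Qed.

Lemma near_lt_ratio a : a < rho -> \forall n \near \oo, a * n%:R < (k n)%:R :> R.
Proof.
move=> ar; near=> n.
have n0 : 0 < n%:R :> R by rewrite ltr0n; near: n; exact: nbhs_infty_gt.
rewrite -ltr_pdivlMr//; near: n; exact: cvgr_gt ratio_cvg _ ar.
Unshelve. all: by end_near. Qed.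

Lemma near_ratio_lt a : rho < a -> \forall n \near \oo, (k n)%:R < a * n%:R :> R.
Proof.
move=> ar; near=> n.
have n0 : 0 < n%:R :> R by rewrite ltr0n; near: n; exact: nbhs_infty_gt.
rewrite -ltr_pdivrMr//; near: n; exact: cvgr_lt ratio_cvg _ ar.
Unshelve. all: by end_near. Qed.

Lemma near_index_lt : \forall n \near \oo, (k n < n)%N.
Proof.
have r1 : rho < 1 by rewrite -subr_gt0.
by near=> n; rewrite -(ltr_nat R) -[n%:R]mul1r; near: n; exact: near_ratio_lt.
Unshelve. all: by end_near. Qed.

Lemma index_cvgy : k n @[n --> \oo] --> \oo.
Proof.
apply/cvgnyPge => A; near=> n.
rewrite -(ler_nat R); apply: ltW; apply: le_lt_trans (_ : rho / 2 * n%:R < _).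
  rewrite mulrC -ler_pdivrMr ?divr_gt0//.
  by near: n; exact: nbhs_infty_ger.
by near: n; apply: near_lt_ratio; have := rho0; lra.
Unshelve. all: by end_near. Qed.

Lemma coindex_cvgy : (n - k n)%N @[n --> \oo] --> \oo.
Proof.
have h0 : 0 < (1 - rho) / 2 by rewrite divr_gt0.
apply/cvgnyPge => A; near=> n.
have kn : (k n < n)%N by near: n; exact: near_index_lt.
rewrite -(ler_nat R) natrB 1?ltnW//.
have h1 : (k n)%:R < (1 - (1 - rho) / 2) * n%:R :> R.
  by near: n; apply: near_ratio_lt; have := rho1; lra.
have h2 : A%:R <= (1 - rho) / 2 * n%:R :> R.
  by rewrite mulrC -ler_pdivrMr//; near: n; exact: nbhs_infty_ger.
lra.
Unshelve. all: by end_near. Qed.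

Let kp n : R := (k n)%:R / (rho * n%:R).
Let kq n : R := (n%:R - (k n)%:R) / ((1 - rho) * n%:R).

Lemma relative_ratio_cvg : kp n @[n --> \oo] --> (1 : R).
Proof.
have -> : kp = (fun n => ((k n)%:R / n%:R) * rho^-1).
  by apply/funext => n; rewrite /kp invfM mulrA mulrAC.
by rewrite -[X in _ --> X](divff (lt0r_neq0 rho0)); apply: cvgMl; exact: ratio_cvg.
Qed.

Lemma relative_coratio_cvg : kq n @[n --> \oo] --> (1 : R).
Proof.
have H : (1 - (k n)%:R / n%:R) * (1 - rho)^-1 @[n --> \oo] --> (1 : R).
  rewrite -[X in _ --> X](divff (lt0r_neq0 rho1)); apply: cvgMl.
  by apply: cvgB; [exact: cvg_cst|exact: ratio_cvg].
apply: cvg_trans H; apply: near_eq_cvg; near=> n.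
have n0 : n%:R != 0 :> R by rewrite pnatr_eq0 -lt0n; near: n; exact: nbhs_infty_gt.
by rewrite /kq; field; rewrite n0 gt_eqF.
Unshelve. all: by end_near. Qed.

(** This is n times the relative entropy D(k/n || rho).  It is nonnegative and at
    most the chi-square distance x^2 / (n rho (1 - rho)), both by
    1 - 1/y <= ln y <= y - 1. *)
Lemma entropy_cvg0 :
  (k n)%:R * ln (kp n) + (n%:R - (k n)%:R) * ln (kq n) @[n --> \oo] --> (0 : R).
Proof.
apply: (@squeeze_cvgr _ _ _ _ (fun=> 0)
    (fun n => (x n ^+ 2 / n%:R) * (rho * (1 - rho))^-1)).
- near=> n.
  have n0 : 0 < n%:R :> R by rewrite ltr0n; near: n; exact: nbhs_infty_gt.
  have kn : (k n)%:R < n%:R :> R by rewrite ltr_nat; near: n; exact: near_index_lt.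
  have k0 : 0 < (k n)%:R :> R.
    by rewrite -(mul0r n%:R); near: n; exact: near_lt_ratio.
  move: n0 kn k0; rewrite /kp /kq /x; move: (k n)%:R n%:R => a b b0 ab a0.
  have ba0 : 0 < b - a by rewrite subr_gt0.
  have rb0 : 0 < rho * b by rewrite mulr_gt0.
  have sb0 : 0 < (1 - rho) * b by rewrite mulr_gt0.
  (* ln y >= 1 - 1/y at y = u/v; the two lower bounds add up to 0 *)
  have lower (u v : R) : 0 < u -> 0 < v -> u - v <= u * ln (u / v).
    move=> u0 v0; have -> : ln (u / v) = - ln (v / u).
      by rewrite -lnV ?posrE ?divr_gt0// invf_div.
    have w0 : 0 < v / u by rewrite divr_gt0.
    have : ln (1 + (v / u - 1)) <= v / u - 1 by rewrite le_ln1Dx//; lra.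
    rewrite addrC subrK -(ler_pM2l u0) mulrBr mulr1 mulrCA divff ?gt_eqF//; lra.
  have upper (u v : R) : 0 < u -> 0 < v -> u * ln (u / v) <= u * (u / v - 1).
    move=> u0 v0; rewrite ler_pM2l//.
    have w0 : 0 < u / v by rewrite divr_gt0.
    have : ln (1 + (u / v - 1)) <= u / v - 1 by rewrite le_ln1Dx//; lra.
    by rewrite addrC subrK.
  apply/andP; split.
    have := lower _ _ a0 rb0; have := lower _ _ ba0 sb0; lra.
  apply: le_trans (lerD (upper _ _ a0 rb0) (upper _ _ ba0 sb0)) _.
  rewrite le_eqVlt; apply/orP; left; apply/eqP.
  by field; rewrite !gt_eqF.
- exact: cvg_cst.
- rewrite -[X in _ --> X](mul0r (rho * (1 - rho))^-1); apply: cvgMl.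
  exact: sqr_dev_cvg0.
Unshelve. all: by end_near. Qed.

Lemma ln_binom_mass (n m : nat) : (m < n)%N ->
  ln (binom_mass p n m) = ln n`!%:R - ln m`!%:R - ln (n - m)`!%:R
    + m%:R * ln p + (n%:R - m%:R) * ln (1 - p).
Proof.
move=> mn; case/andP: hp => p0 p1.
have q0 : 0 < 1 - p by lra.
have b0 : 0 < 'C(n, m)%:R :> R by rewrite ltr0n bin_gt0 ltnW.
have := congr1 (fun i : nat => ln i%:R : R) (bin_fact (ltnW mn)).
rewrite /= !natrM lnM ?posrE ?mulr_gt0 ?ltr0n ?fact_gt0//; last by rewrite -(ltr0n R).
rewrite lnM ?posrE ?mulr_gt0 ?ltr0n ?fact_gt0// => <-.
move: (ln m`!%:R) (ln (n - m)`!%:R) => F G.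
rewrite /binom_mass -(natrB _ (ltnW mn)).
move: 'C(n, m)%:R (n - m)%N b0 => c l c0.
rewrite lnM ?posrE ?mulr_gt0 ?exprn_gt0// lnM ?posrE ?exprn_gt0//.
rewrite !lnXn// -[ln p *+ m]mulr_natl -[ln (1 - p) *+ l]mulr_natl; ring.
Qed.

Let scaled_log n := n%:R * ln 2 + ln (binom_mass p n (k n)) - z n * ln kap.

(** The exponential terms collapse: the defining equation of rho_star turns
    n ln 2 + k ln p + (n-k) ln (1-p) into
    k ln rho + (n-k) ln (1-rho) + x ln kappa, and (x - z) ln kappa is half of
    ln (beta n) by definition of the centering. *)
Lemma scaled_logE : \forall n \near \oo, scaled_log n =
  stirling_log n - stirling_log (k n) - stirling_log (n - k n) + ln (2 * pi) / 2
  - (ln (kp n) + ln (kq n)) / 2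
  - ((k n)%:R * ln (kp n) + (n%:R - (k n)%:R) * ln (kq n)).
Proof.
case/andP: hp => p0 p1.
have q0 : 0 < 1 - p by lra.
near=> n.
have n0 : 0 < n%:R :> R by rewrite ltr0n; near: n; exact: nbhs_infty_gt.
have kn : (k n < n)%N by near: n; exact: near_index_lt.
have knR : 0 < n%:R - (k n)%:R :> R by rewrite subr_gt0 ltr_nat.
have k0 : 0 < (k n)%:R :> R.
  by rewrite -(mul0r n%:R); near: n; exact: near_lt_ratio.
rewrite /scaled_log ln_binom_mass// !ln_fact (natrB _ (ltnW kn)).
have kpE : ln (kp n) = ln (k n)%:R - ln rho - ln n%:R.
  by rewrite /kp ln_div ?posrE ?mulr_gt0// lnM ?posrE//; ring.
have kqE : ln (kq n) = ln (n%:R - (k n)%:R) - ln (1 - rho) - ln n%:R.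
  by rewrite /kq ln_div ?posrE ?mulr_gt0// lnM ?posrE//; ring.
have zE : z n * ln kap =
    x n * ln kap - (ln (2 * pi) + ln rho + ln (1 - rho) + ln n%:R) / 2.
  have bE : ln (beta p * n%:R) = ln (2 * pi) + ln rho + ln (1 - rho) + ln n%:R.
    by rewrite /beta lnM ?posrE ?beta_gt0// !lnM ?posrE ?mulr_gt0 ?pi_gt0.
  rewrite -bE /z /x /centering -/rho -/kap ltr0_norm//.
  by field; rewrite lt_eqF.
have kapE : ln kap = ln p + ln (1 - rho) - ln (1 - p) - ln rho by exact: ln_kappa.
have := rho_star_rate hp; rewrite /rate_gap -/rho => rate.
have -> : ln 2 = rho * (ln rho - ln p) +
    (1 - rho) * (ln (1 - rho) - ln (1 - p)) :> R by lra.
rewrite kpE kqE zE kapE /x.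
by field.
Unshelve. all: by end_near. Qed.

Lemma scaled_log_cvg0 : scaled_log n @[n --> \oo] --> (0 : R).
Proof.
apply: cvg_trans.
  by apply: near_eq_cvg; near=> n; symmetry; near: n; exact: scaled_logE.
set s := ln (2 * pi) / 2.
have S1 := @stirling_log_lim R.
have S2 : stirling_log (k n) @[n --> \oo] --> s by exact: cvg_comp index_cvgy S1.
have S3 : stirling_log (n - k n) @[n --> \oo] --> s by exact: cvg_comp coindex_cvgy S1.
have -> : 0 = s - s - s + s - (0 + 0) / 2 - 0 :> R.
  by rewrite addr0 mul0r !subr0 subrr sub0r addNr.
apply: cvgB; last exact: entropy_cvg0.
apply: cvgB; last first.
  by apply: cvgMl; apply: cvgD; apply: ln_cvg0;
    [exact: relative_ratio_cvg|exact: relative_coratio_cvg].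
apply: cvgD; last exact: cvg_cst.
by apply: cvgB => //; exact: cvgB.
Unshelve. all: by end_near. Qed.

(** Exponential form of [scaled_log_cvg0]. *)
Lemma scaled_mass_cvg1 :
  2 ^+ n * binom_mass p n (k n) * kap `^ (- z n) @[n --> \oo] --> (1 : R).
Proof.
have H : expR (scaled_log n) @[n --> \oo] --> (1 : R).
  rewrite -[X in _ --> X]expR0.
  exact: cvg_comp scaled_log_cvg0 (@continuous_expR R 0).
apply: cvg_trans H; apply: near_eq_cvg; near=> n.
have kn : (k n < n)%N by near: n; exact: near_index_lt.
case/andP: hp => p0 p1.
have b0 : 0 < binom_mass p n (k n).
  by apply: binom_mass_gt0; [apply/andP; split; lra|exact: ltnW].
rewrite /scaled_log expRD expRD lnK ?posrE// mulrC -mulNr.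
have -> : expR (- z n * ln kap) = kap `^ (- z n).
  by rewrite /powR gt_eqF.
rewrite mulrC; congr (_ * _ * _).
by rewrite mulr_natl -lnXn// lnK// posrE exprn_gt0.
Unshelve. all: by end_near. Qed.

(** Dividing [binom_tail_excess] by n b: with y = k/n and T = Q/b, T equals
    q y / (y - p) up to V / (n b (y - p)), which [binom_excess_le] bounds by
    O(T / n).  The limit q rho / (rho - p) is 1 / (1 - kappa). *)
Lemma tail_mass_ratio_cvg :
  binom_tail p n (k n) / binom_mass p n (k n) @[n --> \oo] --> (1 - kap)^-1.
Proof.
case/andP: (hp) => p0 p1.
have prho : 0 < rho - p by rewrite subr_gt0; exact: rho_star_gt.
pose y n : R := (k n)%:R / n%:R.
pose up n := (1 - p) * y n / (y n - p).
have upE : (1 - kap)^-1 = (1 - p) * rho / (rho - p).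
  rewrite /kap /kappa -/rho; field.
  by rewrite !gt_eqF//=; have := rho0; nra.
have ym : y n - p @[n --> \oo] --> rho - p.
  by apply: cvgB; [exact: ratio_cvg|exact: cvg_cst].
have yV : (y n - p)^-1 @[n --> \oo] --> (rho - p)^-1.
  by apply: cvgV => //; rewrite gt_eqF.
have cup : up n @[n --> \oo] --> (1 - kap)^-1.
  rewrite upE; apply: cvgM => //.
  by apply: cvgMr; exact: ratio_cvg.
have clo : up n - up n * p * ((y n - p)^-1 * (y n - p)^-1) * n%:R^-1
    @[n --> \oo] --> (1 - kap)^-1.
  rewrite -[X in _ --> X]subr0; apply: cvgB => //.
  rewrite -[X in _ --> X](mulr0 ((1 - kap)^-1 * p * ((rho - p)^-1 * (rho - p)^-1))).
  apply: cvgM; last exact: natV_cvg0.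
  by apply: cvgM; [exact: cvgMl|exact: cvgM].
apply: squeeze_cvgr clo cup.
near=> n.
have n0 : 0 < n%:R :> R by rewrite ltr0n; near: n; exact: nbhs_infty_gt.
have kn : (k n < n)%N by near: n; exact: near_index_lt.
have y0 : 0 < y n - p.
  by near: n; exact: cvgr_gt ym _ prho.
have p01 : 0 < p < 1 by apply/andP; split; lra.
have b0 : 0 < binom_mass p n (k n) by apply: binom_mass_gt0 => //; exact: ltnW.
have eq := binom_tail_excess p (ltnW kn).
have le := binom_excess_le p01 (ltnW kn).
have V0 := binom_excess_ge0 n p01 (k n).
have Q0 := binom_tail_ge0 n p01 (k n).
have kE : (k n)%:R = y n * n%:R by rewrite /y divfK ?gt_eqF.
move: eq le V0 Q0 b0 y0; rewrite /up kE.
move: (binom_tail _ _ _) (binom_excess _ _ _) (binom_mass _ _ _) (y n) n%:R n0.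
move=> Q V b w N N0 eq le V0 Q0 b0 w0.
have wN0 : 0 < (w - p) * N by rewrite mulr_gt0.
have QE : Q / b = (1 - p) * w / (w - p) - V / (b * N * (w - p)).
  have -> : Q = ((1 - p) * (w * N) * b - V) / ((w - p) * N).
    by rewrite -eq; field; rewrite !gt_eqF.
  by field; rewrite !gt_eqF.
have QU : Q / b <= (1 - p) * w / (w - p).
  by rewrite QE gerBl divr_ge0// !mulr_ge0// ltW.
apply/andP; split => //.
rewrite QE lerB//.
apply: le_trans (_ : Q / b * p * ((w - p)^-1 * (w - p)^-1) * N^-1 <= _); last first.
  have iw : 0 <= (w - p)^-1 by rewrite invr_ge0 ltW.
  have iN : 0 <= N^-1 by rewrite invr_ge0 ltW.
  do 2! [apply: ler_wpM2r; first by rewrite ?mulr_ge0].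
  by apply: ler_wpM2r => //; exact: ltW.
have -> : V / (b * N * (w - p)) =
    (w * N - p * N) * V * (b * N * N * (w - p) * (w - p))^-1.
  by field; rewrite !gt_eqF.
have -> : Q / b * p * ((w - p)^-1 * (w - p)^-1) * N^-1 =
    p * N * Q * (b * N * N * (w - p) * (w - p))^-1.
  by field; rewrite !gt_eqF.
by rewrite ler_wpM2r// invr_ge0 !mulr_ge0// ltW.
Unshelve. all: by end_near. Qed.

Lemma scaled_tail_cvg :
  2 ^+ n * binom_tail p n (k n) * kap `^ (- z n) @[n --> \oo] --> (1 - kap)^-1.
Proof.
have H : 2 ^+ n * binom_mass p n (k n) * kap `^ (- z n) *
    (binom_tail p n (k n) / binom_mass p n (k n)) @[n --> \oo] --> (1 - kap)^-1.
  rewrite -[X in _ --> X]mul1r; apply: cvgM; first exact: scaled_mass_cvg1.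
  exact: tail_mass_ratio_cvg.
apply: cvg_trans H; apply: near_eq_cvg; near=> n.
have kn : (k n < n)%N by near: n; exact: near_index_lt.
case/andP: hp => p0 p1.
have b0 : 0 < binom_mass p n (k n).
  by apply: binom_mass_gt0; [apply/andP; split; lra|exact: ltnW].
move: (binom_mass _ _ _) b0 (binom_tail _ _ _) (kap `^ _) (2 ^+ n) => b b0 Q u v.
by field; rewrite gt_eqF.
Unshelve. all: by end_near. Qed.

(** 2^n Q kappa^(-z) converges and kappa^(-z) is bounded below, as z is
    bounded, so Q is O(2^-n). *)
Lemma tail_cvg0 : binom_tail p n (k n) @[n --> \oo] --> (0 : R).
Proof.
have G : geometric 1 (2^-1) n @[n --> \oo] --> (0 : R).
  by apply: cvg_geometric; rewrite ger0_norm ?invr_ge0// invf_lt1// ltr1n.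
pose M := kap `^ (- `|C|).
have H : 2 ^+ n * binom_tail p n (k n) * kap `^ (- z n) * (geometric 1 (2^-1) n * M)
    @[n --> \oo] --> (0 : R).
  rewrite -[X in _ --> X](mulr0 (1 - kap)^-1).
  apply: cvgM; first exact: scaled_tail_cvg.
  by rewrite -[X in _ --> X](mul0r M); exact: cvgMl.
apply: squeeze_cvgr (cvg_cst 0) H; near=> n.
case/andP: (hp) => p0 p1.
have p01 : 0 < p < 1 by apply/andP; split; lra.
have Q0 := binom_tail_ge0 n p01 (k n).
apply/andP; split=> //=.
have zC : - `|C| <= z n.
  rewrite lerNl; apply: le_trans (ler_norm _) _; rewrite normrN.
  by apply: le_trans (ler_norm C); rewrite /z; near: n.
have uM : 1 <= kap `^ (- z n) * M.
  rewrite /M -powRD; last by apply/implyP => _; rewrite gt_eqF.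
  rewrite -[leLHS](powRr0 kap); apply: ger_powR; last by lra.
  by rewrite kap0 ltW// kappa_lt1.
have e : 2 ^+ n * 2^-1 ^+ n = 1 :> R by rewrite -exprMn divff// expr1n.
rewrite mul1r.
have -> : 2 ^+ n * binom_tail p n (k n) * kap `^ (- z n) * (2^-1 ^+ n * M) =
    (2 ^+ n * 2^-1 ^+ n) * (binom_tail p n (k n) * (kap `^ (- z n) * M)).
  by move: (2 ^+ n) (2^-1 ^+ n) => *; ring.
by rewrite e mul1r ler_peMr.
Unshelve. all: by end_near. Qed.

(** Q <= - ln (1 - Q) <= Q / (1 - Q), and Q tends to 0. *)
Lemma log_tail_cvg1 :
  - (2 ^+ n * ln (1 - binom_tail p n (k n))) * (1 - kap) * kap `^ (- z n)
    @[n --> \oo] --> (1 : R).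
Proof.
have k1 : 0 < 1 - kap by rewrite subr_gt0 kappa_lt1.
have r1 : 2 ^+ n * binom_tail p n (k n) * kap `^ (- z n) * (1 - kap)
    @[n --> \oo] --> (1 : R).
  rewrite -[X in _ --> X](@mulVf _ (1 - kap)) ?gt_eqF//.
  by apply: cvgMl; exact: scaled_tail_cvg.
have Q1 : 1 - binom_tail p n (k n) @[n --> \oo] --> (1 : R).
  by rewrite -[X in _ --> X]subr0; apply: cvgB; [exact: cvg_cst|exact: tail_cvg0].
have r2 : 2 ^+ n * binom_tail p n (k n) * kap `^ (- z n) * (1 - kap) *
    (1 - binom_tail p n (k n))^-1 @[n --> \oo] --> (1 : R).
  rewrite -[X in _ --> X](divff (@oner_neq0 R)).
  by apply: cvgM => //; apply: cvgV => //; exact: oner_neq0.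
apply: squeeze_cvgr r1 r2; near=> n.
have q0 : 0 < 1 - binom_tail p n (k n).
  by near: n; exact: cvgr_gt Q1 _ ltr01.
have m0 : 0 <= 2 ^+ n * kap `^ (- z n) * (1 - kap).
  by rewrite !mulr_ge0 ?exprn_ge0 ?powR_ge0// ltW.
move: (binom_tail _ _ _) q0 => Q q0.
have lo : Q <= - ln (1 - Q) by rewrite lerNr le_ln1Dx//; lra.
have hi : - ln (1 - Q) <= Q * (1 - Q)^-1.
  rewrite -lnV ?posrE//.
  have i0 : 0 < (1 - Q)^-1 by rewrite invr_gt0.
  have iE : (1 - Q)^-1 = 1 + Q * (1 - Q)^-1 by field; rewrite gt_eqF.
  rewrite [in ln _]iE; apply: le_ln1Dx; lra.
have := ler_wpM2l m0 lo; have := ler_wpM2l m0 hi.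
move: (2 ^+ n) (kap `^ _) (ln _) (_^-1) => a u l v h1 h2.
by apply/andP; split; lra.
Unshelve. all: by end_near. Qed.

End local_limit.

(** * Uniformity over the window *)

Lemma centering_ratio_cvg {R : realType} (p : R) : 0 < p < 1 / 2 ->
  centering p n / n%:R @[n --> \oo] --> rho_star p.
Proof.
move=> hp; pose D := (2 * `|ln (kappa p)|)^-1.
have L0 : ln n%:R / n%:R @[n --> \oo] --> (0 : R).
  have H : 4 * Num.sqrt (Num.sqrt n%:R^-1) * Num.sqrt n%:R^-1 @[n --> \oo] --> (0 : R).
    rewrite -[X in _ --> X](mulr0 (4 * 0)); apply: cvgM; last exact: sqrt_natV_cvg0.
    by apply: cvgMr; exact: sqrt_sqrt_natV_cvg0.
  apply: squeeze_cvgr (cvg_cst 0) H; near=> n.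
  have n0 : (0 < n)%N by near: n; exact: nbhs_infty_gt.
  rewrite divr_ge0 ?ln_ge0 ?ler1n//=.
  have := ler_wpM2r (sqrtr_ge0 n%:R^-1) (@ln_nat_le R n n0).
  by rewrite -[X in X <= _ -> _]mulrA -expr2 sqr_sqrtr// invr_ge0.
have H : rho_star p - (ln (beta p) * n%:R^-1 + ln n%:R / n%:R) * D
    @[n --> \oo] --> rho_star p.
  rewrite -[X in _ --> X]subr0 -[X in _ - X](mul0r D).
  apply: cvgB; first exact: cvg_cst.
  apply: cvgMl.
  have -> : 0 = ln (beta p) * 0 + 0 :> R by rewrite mulr0 addr0.
  by apply: cvgD => //; apply: cvgMr; exact: natV_cvg0.
apply: cvg_trans H; apply: near_eq_cvg; near=> n.
have n0 : 0 < n%:R :> R by rewrite ltr0n; near: n; exact: nbhs_infty_gt.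
rewrite /centering lnM ?posrE ?beta_gt0// -/D.
by field; rewrite gt_eqF.
Unshelve. all: by end_near. Qed.

Lemma centering_near_ge {R : realType} (p A : R) : 0 < p < 1 / 2 ->
  \forall n \near \oo, A <= centering p n.
Proof.
move=> hp; have /andP[r0 r1] := rho_star_itv hp.
have h0 : 0 < rho_star p / 2 by rewrite divr_gt0.
near=> n.
have n0 : 0 < n%:R :> R by rewrite ltr0n; near: n; exact: nbhs_infty_gt.
apply: le_trans (_ : rho_star p / 2 * n%:R <= _).
  by rewrite mulrC -ler_pdivrMr//; near: n; exact: nbhs_infty_ger.
rewrite -ler_pdivlMr//; apply: ltW; near: n.
by apply: cvgr_gt (centering_ratio_cvg hp) _ _; lra.
Unshelve. all: by end_near. Qed.

(** The error term of the theorem at the integer point k, once the law of the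
    maximum is expressed through the binomial tail. *)
Definition log_tail_err {R : realType} (p : R) (n k : nat) : R :=
  - (2 ^+ n * ln (1 - binom_tail p n k)) * (1 - kappa p) *
  kappa p `^ (- (k%:R - centering p n)) - 1.

(** If the bound failed at some index of the window for infinitely many n, a
    sequence choosing such indices would contradict [log_tail_cvg1]. *)
Lemma log_tail_err_unif {R : realType} (p C e : R) : 0 < p < 1 / 2 -> 0 < e ->
  \forall n \near \oo, forall k : nat, `|k%:R - centering p n| <= C ->
    `|log_tail_err p n k| < e.
Proof.
move=> hp e0.
pose bad n := [set k : nat |
  `|k%:R - centering p n| <= C /\ e <= `|log_tail_err p n k|].
(* the default index is close to the centering, so that the sequence stays in
   a window whether or not a bad index exists *)
pose k n := xget (Num.truncn (centering p n)) (bad n).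
have hk : \forall n \near \oo, `|(k n)%:R - centering p n| <= Num.max C 1.
  near=> n; rewrite /k; case: xgetP => [_ -> [h _]|_].
    by rewrite (le_trans h)// le_max lexx.
  have c0 : 0 <= centering p n by near: n; exact: centering_near_ge.
  have /andP[lo hi] := truncn_itv c0.
  rewrite le_max; apply/orP; right.
  by move: hi; rewrite -natr1 ler_norml => hi; apply/andP; split; lra.
have L := log_tail_cvg1 hp hk.
have L0 : log_tail_err p n (k n) @[n --> \oo] --> (0 : R).
  by rewrite -[X in _ --> X](subrr 1); apply: cvgB => //; exact: cvg_cst.
have small : \forall n \near \oo, `|log_tail_err p n (k n)| < e.
  by move/cvgr0Pnorm_lt: L0; apply.
near=> n => j hj; rewrite ltNge; apply/negP => ej.
have : `|log_tail_err p n (k n)| < e by near: n.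
rewrite /k; case: xgetP => [i _ [_ h]|h]; first by rewrite ltNge h.
by case: (h j).
Unshelve. all: by end_near. Qed.

(** * Laws of the sum and of the maximum *)

Lemma sum_card_set {R : realType} (n : nat) (g : nat -> R) :
  \sum_(A : {set 'I_n}) g #|A| = \sum_(0 <= j < n.+1) 'C(n, j)%:R * g j.
Proof.
have h (A : {set 'I_n}) : (#|A| < n.+1)%N.
  by rewrite ltnS -[n in (_ <= n)%N]card_ord max_card.
rewrite (partition_big (fun A => Ordinal (h A)) xpredT)//= big_mkord.
apply: eq_bigr => j _.
rewrite (eq_bigr (fun=> g j)); last by move=> A /eqP <-.
have -> : 'C(n, j) = #|[set A : {set 'I_n} | #|A| == j]%SET|.
  by rewrite card_draws card_ord.
rewrite sumr_const mulr_natl; congr (_ *+ _).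
by apply: eq_card => A; rewrite [in RHS]inE.
Qed.

Section finite_partition.
Context {d : measure_display} {T : measurableType d} {R : realType}.
Variable P : probability T R.
Local Open Scope ereal_scope.

(** Having total probability 1, the disjoint events E cover the space up to a null
    set; this absorbs the values of Bernoulli variables outside {0, 1}. *)
Lemma measure_fin_partition (J : finType) (E : J -> set T) (F : set T) :
  (forall j, measurable (E j)) -> (forall i j w, E i w -> E j w -> i = j) ->
  \sum_(j : J) P (E j) = 1 -> measurable F ->
  P F = \sum_(j : J) P (F `&` E j).
Proof.
move=> mE Edisj E1 mF.
pose D := [set` index_enum J].
have fD : finite_set D by exact: finite_seq.
have mU : measurable (\bigcup_(j in D) E j) by exact: fin_bigcup_measurable.
have PU : P (\bigcup_(j in D) E j) = 1.
  rewrite measure_fin_bigcup//; last by move=> i j _ _ [w [wi wj]]; exact: Edisj wi wj.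
  by rewrite -fsbig_seq ?index_enum_uniq.
have mFC : measurable (F `&` ~` \bigcup_(j in D) E j).
  by apply: measurableI => //; exact: measurableC.
have PC : P (F `&` ~` \bigcup_(j in D) E j) = 0.
  apply/eqP; rewrite eq_le measure_ge0 andbT.
  apply: le_trans (_ : P (~` \bigcup_(j in D) E j) <= _).
    by apply: le_measure; rewrite ?inE//; exact: measurableC.
  by rewrite probability_setC// PU subee.
have FE : F = (F `&` \bigcup_(j in D) E j) `|` (F `&` ~` \bigcup_(j in D) E j).
  by rewrite -setIUr setUv setIT.
rewrite [in LHS]FE measureU//; last first.
- by rewrite setIACA setICr setI0.
- exact: measurableI.
rewrite [X in _ + X]PC adde0 setI_bigcupr measure_fin_bigcup//.
- by rewrite -fsbig_seq ?index_enum_uniq.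
- by move=> i j _ _ [w [[_ wi] [_ wj]]]; exact: Edisj wi wj.
- by move=> j _; exact: measurableI.
Qed.

End finite_partition.

Section bernoulli_sum.
Context {d : measure_display} {T : measurableType d} {R : realType}.
Variables (P : probability T R) (p : R) (B : nat -> {RV P >-> R}).
Hypothesis B_indep : mutually_independent B.
Hypothesis B_bernoulli : forall i : nat, bernoulli_RV p (B i).

(** Membership is tested on naturals, through the values of the ordinals of A,
    since independence is stated for families indexed by naturals. *)
Let pattern n (A : {set 'I_n}) : set T :=
  \bigcap_(i in [set` iota 0 n])
    B i @^-1` [set (i \in [seq val j | j in A])%:R].

Let patternE n (A : {set 'I_n}) w :
  pattern A w <-> forall j : 'I_n, B j w = (j \in A)%:R.
Proof.
split=> [h j|h i].
  have := h j; rewrite /= mem_iota add0n ltn_ord fintype.mem_image; last exact: val_inj.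
  exact.
rewrite /= mem_iota add0n /= => ni.
by rewrite -[i]/(val (Ordinal ni)) fintype.mem_image ?h//; exact: val_inj.
Qed.

Let pattern_prob n (A : {set 'I_n}) :
  P (pattern A) = (p ^+ #|A| * (1 - p) ^+ (n - #|A|))%:E.
Proof.
rewrite /pattern B_indep ?iota_uniq//.
have -> : iota 0 n = index_iota 0 n by rewrite /index_iota subn0.
rewrite big_mkord.
rewrite (eq_bigr (fun j : 'I_n => (if j \in A then p else 1 - p)%:E)); last first.
  move=> j _; rewrite fintype.mem_image; last exact: val_inj.
  by have [b1 b0] := B_bernoulli j; case: ifP => _; [exact: b1|exact: b0].
rewrite prodEFin; congr EFin.
rewrite (bigID (mem A)) /=.
rewrite (eq_bigr (fun=> p)); last by move=> j ->.
rewrite [X in _ * X](eq_bigr (fun=> 1 - p)); last by move=> j /negbTE ->.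
rewrite !prodr_const; congr (_ * _ ^+ _).
by apply/eqP; rewrite -(eqn_add2l #|A|) cardC card_ord subnKC//
  -[leqRHS]card_ord max_card.
Qed.

(** The events [pattern A], for A a set of indices, partition the space up to a
    null set, and on [pattern A] the sum is the cardinal of A. *)
Lemma bernoulli_sum_prob n (x : R) :
  P [set w | partial_sum B n w < x] =
  (\sum_(0 <= j < n.+1 | j%:R < x) binom_mass p n j)%:E.
Proof.
have mF : measurable [set w | partial_sum B n w < x].
  have mS : measurable_fun setT (partial_sum B n).
    by apply: measurable_sum => i; exact: measurable_funP.
  have := mS measurableT `]-oo, x[%classic (measurable_itv _).
  rewrite setTI; congr (measurable _); apply/seteqP; split => w /=; by rewrite in_itv.
rewrite (@measure_fin_partition _ _ _ P _ (@pattern n))//.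
- rewrite big_mkcond /=.
  rewrite (eq_bigr (fun A : {set 'I_n} =>
      (if #|A|%:R < x then p ^+ #|A| * (1 - p) ^+ (n - #|A|) else 0)%:E)); last first.
    move=> A _.
    have sE w : pattern A w -> partial_sum B n w = #|A|%:R.
      move=> /patternE h; rewrite /partial_sum (eq_bigr _ (fun j _ => h j)).
      by rewrite -natr_sum -big_mkcond sum1_card.
    case: ifP => hA.
      rewrite -pattern_prob; congr (P _); apply/seteqP; split=> w /=; first by case.
      by move=> hw; split => //; rewrite sE.
    rewrite (_ : _ `&` _ = set0) ?measure0// -subset0 => w /= [+ hw].
    by rewrite sE// hA.
  rewrite sumEFin; congr EFin.
  rewrite (sum_card_set n (fun m =>
    if m%:R < x then p ^+ m * (1 - p) ^+ (n - m) else 0)).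
  rewrite [RHS]big_mkcond; apply: eq_bigr => j _; case: ifP => _; last by rewrite mulr0.
  by rewrite mulrA.
- by move=> A; exact: bigcap_measurableType.
- move=> A A' w /patternE h /patternE h'; apply/setP => j.
  have /eqP := h j; rewrite h' => /eqP /esym.
  by case: (j \in A); case: (j \in A') => // /eqP; rewrite ?oner_eq0// eq_sym oner_eq0.
- rewrite (eq_bigr _ (fun A _ => pattern_prob A)) sumEFin; congr EFin.
  rewrite (sum_card_set n (fun m => p ^+ m * (1 - p) ^+ (n - m))).
  by rewrite -[RHS](sum_binom_mass p n); apply: eq_bigr => j _;
    rewrite /binom_mass mulrA.
Qed.

Lemma bernoulli_sum_prob_nat n k :
  P [set w | partial_sum B n w < k%:R] = (1 - binom_tail p n k)%:E.
Proof.
rewrite bernoulli_sum_prob; congr EFin.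
have [kn|nk] := leqP k n.+1; last first.
  have -> : binom_tail p n k = 0 by rewrite /binom_tail big_geq// ltnW.
  rewrite subr0.
  rewrite -[RHS](sum_binom_mass p n) big_mkcond /=.
  by apply: eq_big_nat => j /andP[_ jn]; rewrite ltr_nat (ltn_trans jn nk).
have s1 := sum_binom_mass p n.
rewrite (@big_cat_nat _ _ _ k)//= in s1.
have -> : 1 - binom_tail p n k = \sum_(0 <= j < k) binom_mass p n j.
  by rewrite -s1 addrK.
rewrite big_mkcond (@big_cat_nat _ _ _ k)//=.
rewrite [X in _ + X]big_nat_cond [X in _ + X]big1 ?addr0.
  by apply: eq_big_nat => j /andP[_ jk]; rewrite ltr_nat jk.
by move=> j /andP[/andP[kj _] _]; rewrite ltr_nat ltnNge kj.
Qed.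

End bernoulli_sum.

Lemma max_copies_prob {d : measure_display} {T : measurableType d} {R : realType}
    (P : probability T R) (X : T -> R) (n : nat) (Y : 'I_(2 ^ n) -> {RV P >-> R})
    (x u : R) : independent_copies X Y ->
  P [set w | X w < x] = u%:E ->
  P [set w | max_copies Y w < x] = (u ^+ (2 ^ n))%:E.
Proof.
move=> [ind idd] Xu.
have xE (f : T -> R) : [set w | f w < x] = f @^-1` `]-oo, x[%classic.
  by apply/seteqP; split => w /=; rewrite in_itv.
have -> : [set w | max_copies Y w < x] =
    \bigcap_(j in [set` enum 'I_(2 ^ n)]) (Y j @^-1` `]-oo, x[%classic).
  apply/seteqP; split => w /=.
    by move=> /bigmax_ltP[_ h] j _ /=; rewrite in_itv /= h.
  move=> h; have {}h j : Y j w < x.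
    by have := h j; rewrite /= mem_enum in_itv /=; exact.
  by apply/bigmax_ltP; split.
rewrite (ind _ (fun=> `]-oo, x[%classic)) ?enum_uniq//.
rewrite (eq_bigr (fun=> u%:E)); last first.
  by move=> j _; rewrite idd// -xE Xu.
rewrite prodEFin; congr EFin.
by rewrite big_enum /= prodr_const card_ord.
Qed.

(** * The limit theorem *)

Unset Implicit Arguments.

Theorem theorem3 (R : realType) (d : measure_display) (T : measurableType d)
    (P : probability T R) (p : R) (hp : 0 < p < 1 / 2)
    (B : nat -> {RV P >-> R})
    (B_indep : mutually_independent B)
    (B_bernoulli : forall i : nat, bernoulli_RV p (B i))
    (S : forall n : nat, 'I_(2 ^ n) -> {RV P >-> R})
    (S_copies : forall n : nat, independent_copies (partial_sum B n) (S n))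
    (I : set R) (I_interval : is_interval I) (I_bounded : bounded_set I) :
  exists eps : nat -> R -> R,
    (\forall n \near \oo, forall z : R, I z ->
       P [set w | max_copies (S n) w < centering p n + z] =
       (expR (- (kappa p `^ z / (1 - kappa p) * (1 + eps n z))))%:E)
    /\
    (forall e : R, 0 < e -> \forall n \near \oo, forall z : R,
       I z -> centering p n + z \is a Num.int -> `|eps n z| < e).
Proof.
have [C IC] : exists C : R, forall z, I z -> `|z| <= C.
  by case: I_bounded => M [_ hM]; exists (M + 1) => z Iz; apply: hM => //;
    rewrite ltrDl.
have k0 : 0 < kappa p by exact: kappa_gt0.
have k1 : 0 < 1 - kappa p by rewrite subr_gt0 kappa_lt1.
pose u n (x : R) := \sum_(0 <= j < n.+1 | j%:R < x) binom_mass p n j.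
have MP n x : P [set w | max_copies (S n) w < x] = (u n x ^+ (2 ^ n))%:E.
  exact: max_copies_prob (S_copies n) (bernoulli_sum_prob B_indep B_bernoulli n x).
have u0 n x : 0 < x -> 0 < u n x.
  move=> x0; case/andP: (hp) => p0 p1.
  have p01 : 0 < p < 1 by apply/andP; split; lra.
  (* the term j = 0 of the sum is already positive *)
  rewrite /u big_mkcond big_ltn//= x0 ltr_pwDl ?binom_mass_gt0//.
  by apply: sumr_ge0 => j _; case: ifP => // _; exact: binom_mass_ge0.
have x0 : \forall n \near \oo, forall z, I z -> 0 < centering p n + z.
  near=> n => z /IC; rewrite ler_norml => /andP[zC _].
  have : C + 1 <= centering p n by near: n; exact: centering_near_ge.
  lra.
exists (fun n z => - ln (u n (centering p n + z) ^+ (2 ^ n)) * (1 - kappa p) *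
  kappa p `^ (- z) - 1); split.
  near=> n => z Iz; rewrite MP; congr EFin.
  have un0 : 0 < u n (centering p n + z).
    by apply: u0; move: z Iz; near: n.
  have kz0 : 0 < kappa p `^ z by rewrite powR_gt0.
  rewrite -[LHS]lnK ?posrE ?exprn_gt0//; congr expR; rewrite powRN.
  by field; rewrite !gt_eqF.
move=> e e0; near=> n => z Iz zint.
have xn0 : 0 < centering p n + z by move: z Iz {zint}; near: n.
have /natrP[k kE] : centering p n + z \is a Num.nat by rewrite natrEint zint ltW.
have un0 := u0 n _ xn0.
have zE : k%:R - centering p n = z by rewrite -kE addrC addKr.
have uE : u n (centering p n + z) = 1 - binom_tail p n k.
  apply: EFin_inj; rewrite kE /u -(bernoulli_sum_prob B_indep B_bernoulli).
  exact: (bernoulli_sum_prob_nat B_indep B_bernoulli).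
have : `|log_tail_err p n k| < e.
  suff : forall k : nat, `|k%:R - centering p n| <= C -> `|log_tail_err p n k| < e.
    by apply; rewrite zE; exact: IC.
  by near: n; exact: log_tail_err_unif.
rewrite /log_tail_err zE lnXn// uE -[ln _ *+ _]mulr_natl natrX.
by [].
Unshelve. all: by end_near. Qed.
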